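(* Let $q\in(0,1)$ and let $a,b$ be real numbers such that $0<a<b$. Then $$\frac{\left(\frac{1-q^b}{1-q}\right)^{b-1}}{\left(\frac{1-q^a}{1-q}\right)^{a-1}}\exp\left(\frac{\mathrm{Li}_2(1-q^b)-\mathrm{Li}_2(1-q^a)}{\log q}\right)\le\frac{\Gamma_q(b)}{\Gamma_q(a)}\le\frac{\left(\frac{1-q^b}{1-q}\right)^{b-\frac12}}{\left(\frac{1-q^a}{1-q}\right)^{a-\frac12}}\exp\left(\frac{\mathrm{Li}_2(1-q^b)-\mathrm{Li}_2(1-q^a)}{\log q}\right).$$
   Context: For $0<q<1$ and $x>0$, the $q$-gamma function is $\Gamma_q(x)=(1-q)^{1-x}\prod_{j=0}^{\infty}\frac{1-q^{j+1}}{1-q^{j+x}}$. The dilogarithm is $\mathrm{Li}_2(z)=-\int_0^z\frac{\log(1-t)}{t}\,dt$ for $0<z<1$. *)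

(* Defs.v *)
(* Stdlib real numbers with Coquelicot. *)
From Stdlib Require Import Reals.
From Coquelicot Require Import Coquelicot.
Open Scope R_scope.

(* [prod_f_R0 f n] is the product of f 0, ..., f n. [real] sends infinite limits
   to 0, but for 0 < q < 1 and x > 0 the partial products converge in R. *)
Definition qGamma (q x : R) : R :=
  Rpower (1 - q) (1 - x) *
  real (Lim_seq (prod_f_R0 (fun j : nat =>
    (1 - Rpower q (INR j + 1)) / (1 - Rpower q (INR j + x))))).

(* For 0 < z < 1 the singularity of the integrand at 0 is removable, so this is
   a proper Riemann integral, independent of the value taken at t = 0. *)
Definition Li2 (z : R) : R := - RInt (fun t : R => ln (1 - t) / t) 0 z.

(* Main.v *)
Require Import Defs.
From Stdlib Require Import Reals.
From Coquelicot Require Import Coquelicot.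
From Stdlib Require Import Lra.
Open Scope R_scope.

(** Write [F x = - ln (1 - q^x)] ([log_factor]), the logarithm of one factor
    [1 / (1 - q^x)] of the product, and [f = F'].  By the product formula [ln Gamma_q x] is
    [sum_(j >= 0) F (x + j)] plus [(1 - x) ln (1 - q)] plus a constant.  The
    two bounds are what Euler-Maclaurin summation predicts for that series:
    because [Li2' z = - ln (1 - z) / z] and [ln (q^x) = x ln q], the function
    [G x = x F x - Li2 (1 - q^x) / ln q] is a primitive of [F]
    ([is_derive_log_factor_prim]).  Hence, with [c = 1] for the lower bound and
    [c = 1/2] for the upper one, the quotient of the bound by
    [Gamma_q b / Gamma_q a] is [exp (h_c a - h_c b)], where
    [h_c x = sum_(j >= 0) F (x + j) + G x - c F x]
    ([bound_eq_exp_remainder]).  It remains to see that [h_1] is nondecreasing and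
    [h_(1/2)] is nonincreasing.

    Formally [h_c' x = sum_(j >= 0) f (x + j) - c f x - int_x^oo f], the error of
    a quadrature rule for [int_x^oo f]: right endpoints for [c = 1], trapezoids
    for [c = 1/2].  As [f] is increasing the first error is nonnegative
    ([step_defect_1_monotone]), and as [f] is concave the second is nonpositive
    ([step_defect_half_antitone]).

    No infinite sum is differentiated: the two monotonicity statements are proved
    for the contribution [step_defect] of a single interval [[x, x+1]], summed by
    telescoping over finitely many of them, and only then passed to the limit.
    There [F] vanishes geometrically at infinity, and so does
    [G (b + n) - G (a + n)] by the mean value theorem
    ([is_lim_seq_sum_step_defect_diff]). *)

(** * Mean value estimates *)

Lemma MVT_is_derive (f df : R -> R) (a b : R) :
  a <= b -> (forall x, a <= x <= b -> is_derive f x (df x)) ->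
  exists c, a <= c <= b /\ f b - f a = df c * (b - a).
Proof.
  intros Hab Hd.
  destruct (MVT_gen f a b df) as [c [Hc Heq]].
  - intros x; rewrite Rmin_left, Rmax_right by lra; intros Hx; apply Hd; lra.
  - intros x; rewrite Rmin_left, Rmax_right by lra; intros Hx.
    apply continuity_pt_filterlim.
    apply (ex_derive_continuous (V := R_NormedModule)).
    exists (df x); now apply Hd.
  - rewrite Rmin_left, Rmax_right in Hc by lra; now exists c.
Qed.

Lemma is_derive_nondecreasing (f df : R -> R) (a b : R) :
  a <= b -> (forall x, a <= x <= b -> is_derive f x (df x)) ->
  (forall x, a <= x <= b -> 0 <= df x) -> f a <= f b.
Proof.
  intros Hab Hd Hpos.
  destruct (MVT_is_derive f df a b Hab Hd) as [c [Hc Heq]].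
  specialize (Hpos c Hc); nra.
Qed.

Lemma increment_le_right_slope (F f : R -> R) (a b : R) :
  a <= b -> (forall x, a <= x <= b -> is_derive F x (f x)) ->
  (forall x, a <= x <= b -> f x <= f b) -> F b - F a <= f b * (b - a).
Proof.
  intros Hab Hd Hmon.
  destruct (MVT_is_derive F f a b Hab Hd) as [c [Hc ->]].
  specialize (Hmon c Hc); nra.
Qed.

(** A concave [f] lies above its chord.  The proof moves the right endpoint: the
    excess of the increment over the trapezoid has derivative
    [(f t - f a - g t (t - a)) / 2], and [f t - f a >= g t (t - a)] because the slope [g] of [f] decreases. *)
Lemma trapezoid_le_increment (F f g : R -> R) (a b : R) :
  a <= b ->
  (forall x, a <= x <= b -> is_derive F x (f x)) ->
  (forall x, a <= x <= b -> is_derive f x (g x)) ->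
  (forall x y, a <= x -> x <= y -> y <= b -> g y <= g x) ->
  (f a + f b) / 2 * (b - a) <= F b - F a.
Proof.
  intros Hab HF Hf Hg.
  set (E t := F t - (f a + f t) / 2 * (t - a)).
  enough (E a <= E b) by (unfold E in *; lra).
  apply (is_derive_nondecreasing E
           (fun t => f t - (g t / 2 * (t - a) + (f a + f t) / 2))); [lra| |].
  - intros x Hx; unfold E.
    assert (HFx := HF x Hx); assert (Hfx := Hf x Hx).
    auto_derive.
    + repeat split; try (eexists; eassumption).
    + rewrite (is_derive_unique (fun t : R => F t) _ _ HFx),
        (is_derive_unique (fun t : R => f t) _ _ Hfx); field.
  - intros x Hx.
    destruct (MVT_is_derive f g a x) as [c [Hc Heq]]; [lra| |].
    + intros y Hy; apply Hf; lra.
    + assert (g x <= g c) by (apply Hg; lra); nra.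
Qed.

(** * The derivative of the dilogarithm *)

(** The value [-1] at [0] is the limit of the quotient; with it, the integrand of
    [Li2] becomes continuous, hence integrable up to the endpoint [0]. *)
Lemma continuous_log_quotient (t : R) :
  t < 1 ->
  continuous (fun t => if Req_EM_T t 0 then -1 else ln (1 - t) / t) t.
Proof.
  intros Ht.
  destruct (Req_EM_T t 0) as [->|Hne].
  - apply continuity_pt_filterlim, continuity_pt_filterlim'.
    destruct (Req_EM_T 0 0) as [_|]; [|lra].
    change (is_lim (fun t => if Req_EM_T t 0 then -1 else ln (1 - t) / t) 0 (-1)).
    apply (is_lim_ext_loc (fun t => - (ln (1 + - t) / - t))).
    + exists (mkposreal 1 Rlt_0_1); intros y _ Hy.
      destruct (Req_EM_T y 0); [contradiction|].
      replace (1 + - y) with (1 - y) by ring; field; lra.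
    + replace (Finite (-1)) with (Rbar_opp 1) by (simpl; f_equal; ring).
      apply is_lim_opp.
      apply (is_lim_comp (fun y => ln (1 + y) / y) Ropp 0 1 0).
      * exact is_lim_div_ln1p_0.
      * rewrite <- Ropp_0 at 2.
        exact (is_lim_opp (fun t => t) 0 0 (is_lim_id 0)).
      * exists (mkposreal 1 Rlt_0_1); intros y _ Hy H.
        injection H; lra.
  - apply (continuous_ext_loc _ (fun t => ln (1 - t) / t)).
    + assert (Hp : 0 < Rabs t) by now apply Rabs_pos_lt.
      exists (mkposreal _ Hp); intros y Hy.
      destruct (Req_EM_T y 0) as [->|]; [|reflexivity].
      unfold ball in Hy; simpl in Hy; unfold AbsRing_ball, abs, minus, plus, opp in Hy.
      simpl in Hy; rewrite Rplus_0_l, Rabs_Ropp in Hy; lra.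
    + apply (ex_derive_continuous (V := R_NormedModule)).
      auto_derive; repeat split; lra.
Qed.

Lemma is_derive_Li2 (z : R) :
  0 < z < 1 -> is_derive Li2 z (- (ln (1 - z) / z)).
Proof.
  intros Hz.
  set (k t := if Req_EM_T t 0 then -1 else ln (1 - t) / t).
  apply (is_derive_ext_loc (fun z => - RInt k 0 z)).
  - assert (Hp : 0 < z) by lra.
    exists (mkposreal _ Hp); intros y Hy.
    unfold ball in Hy; simpl in Hy; unfold AbsRing_ball, abs, minus, plus, opp in Hy.
    simpl in Hy; apply Rabs_def2 in Hy.
    unfold Li2; f_equal; apply RInt_ext; intros x.
    rewrite Rmin_left by lra; intros Hx.
    unfold k; destruct (Req_EM_T x 0); [lra|reflexivity].
  - apply (is_derive_opp (V := R_NormedModule)).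
    replace (ln (1 - z) / z) with (k z)
      by (unfold k; destruct (Req_EM_T z 0); [lra|reflexivity]).
    apply (is_derive_RInt (V := R_NormedModule)) with 0.
    + assert (Hp : 0 < 1 - z) by lra.
      exists (mkposreal _ Hp); intros y Hy.
      unfold ball in Hy; simpl in Hy; unfold AbsRing_ball, abs, minus, plus, opp in Hy.
      simpl in Hy; apply Rabs_def2 in Hy.
      apply (RInt_correct (V := R_CompleteNormedModule)).
      apply (ex_RInt_continuous (V := R_CompleteNormedModule)).
      intros x Hx; apply continuous_log_quotient.
      assert (Rmax 0 y < 1) by (apply Rmax_lub_lt; lra); lra.
    + apply continuous_log_quotient; lra.
Qed.

(** * The logarithm of one factor *)

Lemma exp_le (x y : R) : x <= y -> exp x <= exp y.
Proof. intros [H| ->]; [left; now apply exp_increasing|right; easy]. Qed.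

Lemma ln_lt_0_of_lt_1 (q : R) : 0 < q < 1 -> ln q < 0.
Proof. intros Hq; rewrite <- ln_1; apply ln_increasing; lra. Qed.

Lemma Rpower_base_lt_1 (q x : R) : 0 < q < 1 -> 0 < x -> 0 < Rpower q x < 1.
Proof.
  intros Hq Hx; split; [apply exp_pos|].
  unfold Rpower; rewrite <- exp_0; apply exp_increasing.
  assert (Hl := ln_lt_0_of_lt_1 q Hq); nra.
Qed.

Lemma Rpower_base_antitone (q x y : R) :
  0 < q < 1 -> x <= y -> Rpower q y <= Rpower q x.
Proof.
  intros Hq Hxy; unfold Rpower.
  assert (Hl := ln_lt_0_of_lt_1 q Hq).
  apply exp_le; nra.
Qed.

Definition log_factor (q x : R) : R := - ln (1 - Rpower q x).

Definition log_factor' (q x : R) : R := ln q * (Rpower q x / (1 - Rpower q x)).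

Definition log_factor'' (q x : R) : R :=
  ln q ^ 2 * (Rpower q x / (1 - Rpower q x) ^ 2).

(** Differentiating [x F x] gives [F x + x F' x], and [Li2 (1 - q^x) / ln q] has
    derivative exactly [x F' x], since [ln (q^x) = x ln q]. *)
Definition log_factor_prim (q x : R) : R :=
  x * log_factor q x - Li2 (1 - Rpower q x) / ln q.

Lemma is_derive_Rpower_exponent (q x : R) :
  is_derive (Rpower q) x (ln q * Rpower q x).
Proof. unfold Rpower; auto_derive; [easy|ring]. Qed.

Lemma is_derive_log_factor (q x : R) :
  0 < q < 1 -> 0 < x -> is_derive (log_factor q) x (log_factor' q x).
Proof.
  intros Hq Hx; assert (Hu := Rpower_base_lt_1 q x Hq Hx).
  unfold log_factor, log_factor', Rpower in *; auto_derive; [lra|field; lra].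
Qed.

Lemma is_derive_log_factor' (q x : R) :
  0 < q < 1 -> 0 < x -> is_derive (log_factor' q) x (log_factor'' q x).
Proof.
  intros Hq Hx; assert (Hu := Rpower_base_lt_1 q x Hq Hx).
  unfold log_factor', log_factor'', Rpower in *; auto_derive; [lra|field; lra].
Qed.

Lemma is_derive_log_factor_prim (q x : R) :
  0 < q < 1 -> 0 < x -> is_derive (log_factor_prim q) x (log_factor q x).
Proof.
  intros Hq Hx; assert (Hu := Rpower_base_lt_1 q x Hq Hx).
  assert (Hl := ln_lt_0_of_lt_1 q Hq).
  assert (H1 := is_derive_log_factor q x Hq Hx).
  assert (H2 := is_derive_Li2 (1 - Rpower q x) ltac:(lra)).
  assert (H3 := is_derive_Rpower_exponent q x).
  replace (ln (1 - (1 - Rpower q x))) with (x * ln q) in H2.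
  2: { replace (1 - (1 - Rpower q x)) with (Rpower q x) by ring.
       symmetry; apply ln_exp. }
  unfold log_factor_prim; auto_derive.
  - repeat split; eexists; eassumption.
  - rewrite (is_derive_unique (fun x : R => log_factor q x) _ _ H1).
    rewrite (is_derive_unique (fun x : R => Li2 x) (1 + - Rpower q x) _ H2).
    rewrite (is_derive_unique (fun x : R => Rpower q x) _ _ H3).
    unfold log_factor'; field; lra.
Qed.

Lemma log_factor'_monotone (q x y : R) :
  0 < q < 1 -> 0 < x <= y -> log_factor' q x <= log_factor' q y.
Proof.
  intros Hq Hxy.
  apply (is_derive_nondecreasing _ (log_factor'' q)); [lra| |].
  - intros t Ht; apply is_derive_log_factor'; lra.
  - intros t Ht; destruct (Rpower_base_lt_1 q t Hq) as [H0 H1]; [lra|].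
    unfold log_factor''; apply Rmult_le_pos; [nra|].
    apply Rlt_le, Rdiv_lt_0_compat; nra.
Qed.

(** As [x] grows, [u = q^x] decreases in [(0, 1)], and [u / (1 - u)^2] is increasing
    in [u]; so [log_factor'] is concave. *)
Lemma log_factor''_antitone (q x y : R) :
  0 < q < 1 -> 0 < x <= y -> log_factor'' q y <= log_factor'' q x.
Proof.
  intros Hq Hxy.
  assert (Hx := Rpower_base_lt_1 q x Hq ltac:(lra)).
  assert (Hy := Rpower_base_lt_1 q y Hq ltac:(lra)).
  assert (Hle := Rpower_base_antitone q x y Hq ltac:(lra)).
  unfold log_factor''; apply Rmult_le_compat_l; [nra|].
  apply Rmult_le_compat; [lra| |lra|].
  - apply Rlt_le, Rinv_0_lt_compat; nra.
  - apply Rinv_le_contravar; nra.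
Qed.

(** * Comparison on one unit interval *)

(** The share of [[x, x+1]] in [sum_(j >= 0) F (x + j) + G x - c F x], when [G]
    and [F] are written as telescoping sums of their unit increments. *)
Definition step_defect (c q x : R) : R :=
  log_factor q x - (log_factor_prim q (x + 1) - log_factor_prim q x)
    - c * (log_factor q x - log_factor q (x + 1)).

Lemma is_derive_step_defect (c q x : R) :
  0 < q < 1 -> 0 < x ->
  is_derive (step_defect c q) x
    (log_factor' q x - (log_factor q (x + 1) - log_factor q x)
       - c * (log_factor' q x - log_factor' q (x + 1))).
Proof.
  intros Hq Hx.
  assert (H1 := is_derive_log_factor q x Hq Hx).
  assert (H2 := is_derive_log_factor q (x + 1) Hq ltac:(lra)).
  assert (H3 := is_derive_log_factor_prim q x Hq Hx).
  assert (H4 := is_derive_log_factor_prim q (x + 1) Hq ltac:(lra)).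
  unfold step_defect; auto_derive.
  - repeat split; eexists; eassumption.
  - rewrite (is_derive_unique (fun x : R => log_factor q x) _ _ H1),
      (is_derive_unique (fun x : R => log_factor q x) _ _ H2),
      (is_derive_unique (fun x : R => log_factor_prim q x) _ _ H3),
      (is_derive_unique (fun x : R => log_factor_prim q x) _ _ H4); ring.
Qed.

(** The derivative is [f (x + 1)] minus the integral of the increasing function
    [f] over [[x, x+1]]. *)
Lemma step_defect_1_monotone (q x y : R) :
  0 < q < 1 -> 0 < x <= y -> step_defect 1 q x <= step_defect 1 q y.
Proof.
  intros Hq Hxy.
  eapply is_derive_nondecreasing; [lra| |].
  - intros t Ht; apply is_derive_step_defect; lra.
  - intros t Ht; cbv beta.
    assert (H : log_factor q (t + 1) - log_factor q t
                <= log_factor' q (t + 1) * (t + 1 - t)).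
    { apply increment_le_right_slope; [lra| |].
      - intros s Hs; apply is_derive_log_factor; lra.
      - intros s Hs; apply log_factor'_monotone; lra. }
    lra.
Qed.

(** The derivative is the trapezoidal value on [[x, x+1]] minus the integral of
    the concave function [f]. *)
Lemma step_defect_half_antitone (q x y : R) :
  0 < q < 1 -> 0 < x <= y -> step_defect (1 / 2) q y <= step_defect (1 / 2) q x.
Proof.
  intros Hq Hxy; apply Ropp_le_cancel.
  apply (is_derive_nondecreasing (fun t => - step_defect (1 / 2) q t)
    (fun t => - (log_factor' q t - (log_factor q (t + 1) - log_factor q t)
       - 1 / 2 * (log_factor' q t - log_factor' q (t + 1))))); [lra| |].
  - intros t Ht; apply (is_derive_opp (V := R_NormedModule)).
    apply is_derive_step_defect; lra.
  - intros t Ht; cbv beta.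
    assert (H : (log_factor' q t + log_factor' q (t + 1)) / 2 * (t + 1 - t)
                <= log_factor q (t + 1) - log_factor q t).
    { apply (trapezoid_le_increment _ _ (log_factor'' q)); [lra| | |].
      - intros s Hs; apply is_derive_log_factor; lra.
      - intros s Hs; apply is_derive_log_factor'; lra.
      - intros s u Hs Hsu Hu; apply log_factor''_antitone; lra. }
    lra.
Qed.

Lemma sum_step_defect (c q x : R) (n : nat) :
  sum_n (fun j => step_defect c q (x + INR j)) n
  = sum_n (fun j => log_factor q (x + INR j)) n
    - (log_factor_prim q (x + INR (S n)) - log_factor_prim q x)
    - c * (log_factor q x - log_factor q (x + INR (S n))).
Proof.
  induction n as [|n IH].
  - rewrite !sum_O; unfold step_defect; simpl INR.
    replace (x + 0) with x by ring.
    match goal with |- ?u = ?v => change (@eq R u v) end; ring.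
  - rewrite !sum_Sn, IH; unfold step_defect.
    replace (x + INR (S n) + 1) with (x + INR (S (S n)))
      by (rewrite (S_INR (S n)); ring).
    change (@plus R_AbelianMonoid) with Rplus.
    match goal with |- ?u = ?v => change (@eq R u v) end; ring.
Qed.

(** * Passage to the infinite sum *)

Lemma log_factor_nonneg (q x : R) : 0 < q < 1 -> 0 < x -> 0 <= log_factor q x.
Proof.
  intros Hq Hx; assert (Hu := Rpower_base_lt_1 q x Hq Hx); unfold log_factor.
  assert (ln (1 - Rpower q x) < 0) by (apply ln_lt_0_of_lt_1; lra); lra.
Qed.

(** From [- ln (1 - u) <= u / (1 - u)] at [u = q^x q^n <= q^x]. *)
Lemma log_factor_shift_le_geometric (q x : R) (n : nat) :
  0 < q < 1 -> 0 < x ->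
  log_factor q (x + INR n) <= / (1 - Rpower q x) * q ^ n.
Proof.
  intros Hq Hx; assert (Hn := pos_INR n).
  set (u := Rpower q (x + INR n)).
  assert (Hu : 0 < u < 1) by (apply Rpower_base_lt_1; lra).
  assert (Hx1 := Rpower_base_lt_1 q x Hq Hx).
  assert (Hle : u <= Rpower q x) by (apply Rpower_base_antitone; lra).
  assert (Hun : u = Rpower q x * q ^ n).
  { unfold u; rewrite Rpower_plus, Rpower_pow by lra; reflexivity. }
  assert (Hln : log_factor q (x + INR n) <= u * / (1 - u)).
  { unfold log_factor; fold u; rewrite <- ln_Rinv by lra.
    assert (Hi : 0 < / (1 - u)) by (apply Rinv_0_lt_compat; lra).
    assert (H1 := exp_ineq1_le (ln (/ (1 - u)))).
    rewrite exp_ln in H1 by exact Hi.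
    replace (u * / (1 - u)) with (/ (1 - u) - 1) by (field; lra); lra. }
  apply (Rle_trans _ _ _ Hln).
  assert (Hqn : 0 < q ^ n) by (apply pow_lt; lra).
  assert (Hinv : 0 < / (1 - u)) by (apply Rinv_0_lt_compat; lra).
  assert (Hinv' : / (1 - u) <= / (1 - Rpower q x))
    by (apply Rinv_le_contravar; lra).
  rewrite Rmult_comm.
  apply Rmult_le_compat; nra.
Qed.

Lemma ex_series_log_factor (q x : R) :
  0 < q < 1 -> 0 < x -> ex_series (fun j => log_factor q (x + INR j)).
Proof.
  intros Hq Hx.
  apply (ex_series_le (K := R_AbsRing) (V := R_CompleteNormedModule) _
           (fun j => / (1 - Rpower q x) * q ^ j)).
  - intros n; assert (Hn := pos_INR n).
    change (Rabs (log_factor q (x + INR n)) <= / (1 - Rpower q x) * q ^ n).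
    rewrite Rabs_pos_eq by (apply log_factor_nonneg; lra).
    now apply log_factor_shift_le_geometric.
  - apply (ex_series_scal (V := R_NormedModule)).
    exists (/ (1 - q)); apply is_series_geom; rewrite Rabs_pos_eq; lra.
Qed.

Definition log_factor_sum (q x : R) : R :=
  Series (fun j => log_factor q (x + INR j)).

Lemma is_lim_seq_log_factor_sum (q x : R) :
  0 < q < 1 -> 0 < x ->
  is_lim_seq (sum_n (fun j => log_factor q (x + INR j))) (log_factor_sum q x).
Proof. intros Hq Hx; exact (Series_correct _ (ex_series_log_factor q x Hq Hx)). Qed.

Lemma is_lim_seq_log_factor_shift (q x : R) :
  0 < q < 1 -> 0 < x -> is_lim_seq (fun n => log_factor q (x + INR n)) 0.
Proof. intros Hq Hx; exact (ex_series_lim_0 _ (ex_series_log_factor q x Hq Hx)). Qed.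

(** [G] itself tends to [- Li2 1 / ln q]; looking only at the difference of two
    values avoids the dilogarithm at [1]. *)
Lemma is_lim_seq_log_factor_prim_increment (q a b : R) :
  0 < q < 1 -> 0 < a <= b ->
  is_lim_seq
    (fun n => log_factor_prim q (b + INR n) - log_factor_prim q (a + INR n)) 0.
Proof.
  intros Hq Hab.
  apply (is_lim_seq_le_le (fun _ => 0) _
           (fun n => / (1 - Rpower q a) * q ^ n * (b - a))).
  - intros n; assert (Hn := pos_INR n).
    destruct (MVT_is_derive (log_factor_prim q) (log_factor q) (a + INR n) (b + INR n))
      as [c [Hc ->]]; [lra| |].
    { intros x Hx; apply is_derive_log_factor_prim; lra. }
    assert (H0 : 0 <= log_factor q c) by (apply log_factor_nonneg; lra).
    assert (H1 : log_factor q c <= / (1 - Rpower q a) * q ^ n).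
    { apply Rle_trans with (log_factor q (a + INR n));
        [|apply log_factor_shift_le_geometric; lra].
      assert (Hc1 := Rpower_base_lt_1 q c Hq ltac:(lra)).
      assert (Ha1 := Rpower_base_lt_1 q (a + INR n) Hq ltac:(lra)).
      assert (Hle := Rpower_base_antitone q (a + INR n) c Hq ltac:(lra)).
      unfold log_factor; apply Ropp_le_contravar, ln_le; lra. }
    nra.
  - apply is_lim_seq_const.
  - replace (Finite 0) with (Finite (/ (1 - Rpower q a) * 0 * (b - a)))
      by (f_equal; ring).
    apply (is_lim_seq_scal_r _ (b - a) (Finite (/ (1 - Rpower q a) * 0))).
    apply (is_lim_seq_scal_l _ (/ (1 - Rpower q a)) (Finite 0)).
    apply is_lim_seq_geom; rewrite Rabs_pos_eq; lra.
Qed.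

(** Up to an additive constant, the difference between [ln (qGamma q x)] and the
    logarithm of the expression that bounds it. *)
Definition log_qGamma_remainder (c q x : R) : R :=
  log_factor_sum q x + log_factor_prim q x - c * log_factor q x.

Lemma is_lim_seq_sum_step_defect_diff (c q a b : R) :
  0 < q < 1 -> 0 < a <= b ->
  is_lim_seq
    (fun n => sum_n (fun j => step_defect c q (b + INR j)) n
              - sum_n (fun j => step_defect c q (a + INR j)) n)
    (log_qGamma_remainder c q b - log_qGamma_remainder c q a).
Proof.
  intros Hq Hab.
  apply (is_lim_seq_ext (fun n =>
    (sum_n (fun j => log_factor q (b + INR j)) n
     - sum_n (fun j => log_factor q (a + INR j)) n
     - (log_factor_prim q (b + INR (S n)) - log_factor_prim q (a + INR (S n))))
    + (c * (log_factor q (b + INR (S n)) - log_factor q (a + INR (S n)))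
       + (log_factor_prim q b - log_factor_prim q a
          - c * (log_factor q b - log_factor q a))))).
  { intros n; rewrite !sum_step_defect; ring. }
  replace (Finite (log_qGamma_remainder c q b - log_qGamma_remainder c q a))
    with (Finite (log_factor_sum q b - log_factor_sum q a - 0
      + (c * (0 - 0)
         + (log_factor_prim q b - log_factor_prim q a
          - c * (log_factor q b - log_factor q a)))))
    by (f_equal; unfold log_qGamma_remainder; ring).
  apply is_lim_seq_plus'.
  - apply is_lim_seq_minus'; [apply is_lim_seq_minus'|].
    + apply is_lim_seq_log_factor_sum; lra.
    + apply is_lim_seq_log_factor_sum; lra.
    + apply (is_lim_seq_incr_1
        (fun n => log_factor_prim q (b + INR n) - log_factor_prim q (a + INR n))).
      apply is_lim_seq_log_factor_prim_increment; lra.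
  - apply is_lim_seq_plus'; [|apply is_lim_seq_const].
    apply (is_lim_seq_scal_l _ c (Finite (0 - 0))).
    apply is_lim_seq_minus'.
    + apply (is_lim_seq_incr_1 (fun n => log_factor q (b + INR n))).
      apply is_lim_seq_log_factor_shift; lra.
    + apply (is_lim_seq_incr_1 (fun n => log_factor q (a + INR n))).
      apply is_lim_seq_log_factor_shift; lra.
Qed.

Lemma log_qGamma_remainder_1_monotone (q a b : R) :
  0 < q < 1 -> 0 < a <= b ->
  log_qGamma_remainder 1 q a <= log_qGamma_remainder 1 q b.
Proof.
  intros Hq Hab.
  assert (Hlim := is_lim_seq_sum_step_defect_diff 1 q a b Hq Hab).
  enough (H : 0 <= log_qGamma_remainder 1 q b - log_qGamma_remainder 1 q a) by lra.
  refine (is_lim_seq_le (fun _ => 0) _ 0 (Finite _) _ (is_lim_seq_const 0) Hlim).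
  intros n; apply (proj1 (Rminus_le_0 _ _)), sum_n_m_le; intros j.
  assert (Hj := pos_INR j); apply step_defect_1_monotone; lra.
Qed.

Lemma log_qGamma_remainder_half_antitone (q a b : R) :
  0 < q < 1 -> 0 < a <= b ->
  log_qGamma_remainder (1 / 2) q b <= log_qGamma_remainder (1 / 2) q a.
Proof.
  intros Hq Hab.
  assert (Hlim := is_lim_seq_sum_step_defect_diff (1 / 2) q a b Hq Hab).
  enough (H : log_qGamma_remainder (1 / 2) q b
              - log_qGamma_remainder (1 / 2) q a <= 0)
    by lra.
  refine (is_lim_seq_le _ (fun _ => 0) (Finite _) 0 _ Hlim (is_lim_seq_const 0)).
  intros n; apply Rle_minus, sum_n_m_le; intros j.
  assert (Hj := pos_INR j); apply step_defect_half_antitone; lra.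
Qed.

(** * The q-gamma function *)

Lemma qGamma_partial_product (q x : R) (n : nat) :
  0 < q < 1 -> 0 < x ->
  prod_f_R0 (fun j => (1 - Rpower q (INR j + 1)) / (1 - Rpower q (INR j + x))) n
  = exp (sum_n (fun j => log_factor q (x + INR j)) n
         - sum_n (fun j => log_factor q (1 + INR j)) n).
Proof.
  intros Hq Hx.
  assert (Hfac : forall j,
    (1 - Rpower q (INR j + 1)) / (1 - Rpower q (INR j + x))
    = exp (log_factor q (x + INR j) - log_factor q (1 + INR j))).
  { intros j; assert (Hj := pos_INR j).
    assert (H1 := Rpower_base_lt_1 q (1 + INR j) Hq ltac:(lra)).
    assert (H2 := Rpower_base_lt_1 q (x + INR j) Hq ltac:(lra)).
    rewrite (Rplus_comm (INR j) 1), (Rplus_comm (INR j) x).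
    unfold log_factor.
    replace (- ln (1 - Rpower q (x + INR j)) - - ln (1 - Rpower q (1 + INR j)))
      with (ln (1 - Rpower q (1 + INR j)) + - ln (1 - Rpower q (x + INR j)))
      by ring.
    rewrite exp_plus, exp_Ropp, !exp_ln by lra; reflexivity. }
  induction n as [|n IH].
  - simpl prod_f_R0; rewrite !sum_O; exact (Hfac O).
  - cbn [prod_f_R0]; rewrite IH, Hfac, <- exp_plus, !sum_Sn.
    change (@plus R_AbelianMonoid) with Rplus; f_equal; ring.
Qed.

(** The series at [x] and at [1] converge separately, so the partial products have
    a finite nonzero limit, which the total operators in [qGamma] do not ensure. *)
Lemma qGamma_exp (q x : R) :
  0 < q < 1 -> 0 < x ->
  qGamma q x
  = exp ((1 - x) * ln (1 - q) + (log_factor_sum q x - log_factor_sum q 1)).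
Proof.
  intros Hq Hx; unfold qGamma; rewrite exp_plus; unfold Rpower at 1.
  f_equal.
  rewrite (is_lim_seq_unique _ (exp (log_factor_sum q x - log_factor_sum q 1))); [easy|].
  eapply is_lim_seq_ext.
  { intros n; symmetry; now apply qGamma_partial_product. }
  apply (is_lim_seq_continuous exp); [apply derivable_continuous_pt, derivable_pt_exp|].
  apply is_lim_seq_minus'; apply is_lim_seq_log_factor_sum; lra.
Qed.

(** The powers of [1 - q] in the bound combine to [(1 - q)^(a - b)] for every [c],
    which is the prefactor of [qGamma q b / qGamma q a]; all that is left is the
    difference of remainders. *)
Lemma bound_eq_exp_remainder (c q a b : R) :
  0 < q < 1 -> 0 < a -> 0 < b ->
  Rpower ((1 - Rpower q b) / (1 - q)) (b - c) /
    Rpower ((1 - Rpower q a) / (1 - q)) (a - c) *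
    exp ((Li2 (1 - Rpower q b) - Li2 (1 - Rpower q a)) / ln q)
  = qGamma q b / qGamma q a
    * exp (log_qGamma_remainder c q a - log_qGamma_remainder c q b).
Proof.
  intros Hq Ha Hb.
  assert (Ha1 := Rpower_base_lt_1 q a Hq Ha).
  assert (Hb1 := Rpower_base_lt_1 q b Hq Hb).
  assert (Hl := ln_lt_0_of_lt_1 q Hq).
  rewrite !qGamma_exp by assumption.
  set (u := Rpower q a) in *; set (v := Rpower q b) in *.
  unfold Rpower; rewrite !ln_div by lra.
  assert (Hdiv : forall s t, exp s / exp t = exp (s - t)).
  { intros s t; unfold Rdiv, Rminus; now rewrite <- exp_Ropp, <- exp_plus. }
  rewrite !Hdiv, <- !exp_plus; f_equal.
  unfold log_qGamma_remainder, log_factor_prim, log_factor; fold u v; field; lra.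
Qed.

Theorem corollary3 (q a b : R) (hq : 0 < q < 1) (hab : 0 < a < b) :
  Rpower ((1 - Rpower q b) / (1 - q)) (b - 1) /
    Rpower ((1 - Rpower q a) / (1 - q)) (a - 1) *
    exp ((Li2 (1 - Rpower q b) - Li2 (1 - Rpower q a)) / ln q)
  <= qGamma q b / qGamma q a
  <= Rpower ((1 - Rpower q b) / (1 - q)) (b - 1 / 2) /
       Rpower ((1 - Rpower q a) / (1 - q)) (a - 1 / 2) *
       exp ((Li2 (1 - Rpower q b) - Li2 (1 - Rpower q a)) / ln q).
Proof.
  rewrite !bound_eq_exp_remainder by lra.
  assert (Hpos : 0 < qGamma q b / qGamma q a).
  { rewrite !qGamma_exp by lra; apply Rdiv_lt_0_compat; apply exp_pos. }
  assert (Hlow : exp (log_qGamma_remainder 1 q a - log_qGamma_remainder 1 q b)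
                 <= exp 0).
  { assert (H := log_qGamma_remainder_1_monotone q a b hq ltac:(lra)).
    apply exp_le; lra. }
  assert (Hup : exp 0 <= exp (log_qGamma_remainder (1 / 2) q a
                              - log_qGamma_remainder (1 / 2) q b)).
  { assert (H := log_qGamma_remainder_half_antitone q a b hq ltac:(lra)).
    apply exp_le; lra. }
  rewrite exp_0 in Hlow, Hup; split; nra.
Qed.
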